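(* Let $k \geq 2$ and let $A = (a_{j_1\cdots j_k}) \in \mathbb{R}^{n\times\cdots\times n}$ be an order-$k$ real tensor that is irreducible and satisfies $A \geq 0$. Then $A$ has a positive real (mode-1) $l^k$-eigenvalue with a (mode-1) $l^k$-eigenvector $\mathbf{x}_\ast$ that may be chosen to have all entries non-negative. In fact, $\mathbf{x}_\ast$ is unique and has all entries positive.
   Context: A real tensor of order $k$ in $\mathbb{R}^{n\times\cdots\times n}$ is a $k$-array $A=(a_{j_1\cdots j_k})_{1\le j_1,\dots,j_k\le n}$ of real numbers. It need not be symmetric. $A\geq 0$ means that all $a_{j_1\cdots j_k}\geq 0$. For $\mathbf{x}\in\mathbb{R}^n$, $A(I_n,\mathbf{x},\dots,\mathbf{x})\in\mathbb{R}^n$ is the vector whose $i$-th entry is $\sum_{j_2=1}^n\cdots\sum_{j_k=1}^n a_{i j_2\cdots j_k}x_{j_2}\cdots x_{j_k}$. The $l^k$-norm is $\|\mathbf{x}\|_k=(|x_1|^k+\cdots+|x_n|^k)^{1/k}$. For a positive integer $q$, $\varphi_q(\mathbf{x}) = (\operatorname{sgn}(x_1)|x_1|^q,\dots,\operatorname{sgn}(x_n)|x_n|^q)$, where $\operatorname{sgn}(x)$ is $+1$, $0$, $-1$ according to whether $x>0$, $x=0$, $x<0$. In particular, $\varphi_q(\mathbf{x})=(x_1^q,\dots,x_n^q)$ if all $x_i\ge 0$. A real number $\mu$ is a mode-1 $l^k$-eigenvalue of $A$ with corresponding mode-1 $l^k$-eigenvector $\mathbf{x}\in\mathbb{R}^n$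 if $\|\mathbf{x}\|_k=1$ and $A(I_n,\mathbf{x},\dots,\mathbf{x})=\mu\,\varphi_{k-1}(\mathbf{x})$. The tensor $A$ is reducible if there exists a permutation $\sigma$ of $\{1,\dots,n\}$ such that the permuted tensor $(b_{i_1\cdots i_k})$, defined by $b_{i_1\cdots i_k}=a_{\sigma(i_1)\cdots\sigma(i_k)}$, has the property that for some $m\in\{1,\dots,n-1\}$, $b_{i_1\cdots i_k}=0$ for all $i_1\in\{m+1,\dots,n\}$ and all $i_2,\dots,i_k\in\{1,\dots,m\}$. $A$ is irreducible if it is not reducible.
   Formalization: The formal statement assumes n ≥ 1 and, when n = 1, that A is not the zero tensor: by the given definition the zero tensor with n = 1 is irreducible and non-negative, but its only eigenvalue is 0, so it has no positive eigenvalue. *)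

(* Defs.v *)
From HB Require Import structures.
From mathcomp Require Import all_boot all_order all_algebra all_fingroup.
From mathcomp Require Import reals exp.

Set Implicit Arguments.
Unset Strict Implicit.
Unset Printing Implicit Defensive.

Import Order.TTheory GRing.Theory Num.Theory.

Local Open Scope ring_scope.

Definition tensor (R : realType) (n k : nat) := {ffun k.-tuple 'I_n -> R}.

Section Tensors.
Variables (R : realType) (n k : nat).
Implicit Types (A : tensor R n k) (x y : 'rV[R]_n).

Definition tensor_nonneg A := forall J : k.-tuple 'I_n, 0 <= A J.

(* For k >= 1, the multi-indices J with head i are exactly (i, j_2, ..., j_k),
   with j_2, ..., j_k ranging freely over 'I_n. *)
Definition tensor_apply A x : 'rV[R]_n :=
  \row_(i < n) \sum_(J : k.-tuple 'I_n | ohead J == Some i)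
                 A J * \prod_(j <- behead J) x 0 j.

Definition lnorm (p : nat) x : R := (\sum_(i < n) `|x 0 i| ^+ p) `^ p%:R^-1.

Definition phi (q : nat) x : 'rV[R]_n :=
  \row_(i < n) (Num.sg (x 0 i) * `|x 0 i| ^+ q).

Definition mode1_eigenpair A (mu : R) x :=
  lnorm k x = 1 /\ tensor_apply A x = mu *: phi k.-1 x.

Definition tensor_perm A (s : 'S_n) : tensor R n k :=
  [ffun J : k.-tuple 'I_n => A (map_tuple s J)].

(* Indices run over 0, ..., n-1, so the index blocks {1..m} and {m+1..n} of the
   1-based convention are the i with i < m and with m <= i. *)
Definition reducible A :=
  exists (s : 'S_n) (m : nat), (0 < m < n)%N /\
    forall (i : 'I_n) (J : k.-tuple 'I_n),
      ohead J = Some i -> (m <= i)%N -> all (fun j : 'I_n => j < m)%N (behead J) ->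
      tensor_perm A s J = 0.

(* When n <= 1 there is no admissible m, so every tensor, including the zero
   tensor, is irreducible. *)
Definition irreducible A := ~ reducible A.

End Tensors.

(* Main.v *)
Require Import Defs.
From HB Require Import structures.
From mathcomp Require Import boolp classical_sets.
From mathcomp Require Import topology normedtype derive realfun.
From mathcomp Require Import all_boot all_order all_algebra all_fingroup.
From mathcomp Require Import reals exp.

Set Implicit Arguments.
Unset Strict Implicit.
Unset Printing Implicit Defensive.

Import Order.TTheory GRing.Theory Num.Theory.
Import numFieldNormedType.Exports numFieldTopology.Exports.

Local Open Scope ring_scope.

(* Existence avoids Brouwer's theorem.  By compactness there is a largest lam
   such that lam x_i^(k-1) <= (A x)_i for all i, for some nonzero x >= 0.  If
   equality fails somewhere, raising x slightly off the set of equality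
   indices shrinks this set, by irreducibility, so eventually all the
   inequalities are strict and lam is not maximal.  Positivity of x and
   uniqueness follow from strict monotonicity of A at some index of any
   nonempty proper index set, applied to the zero set of x, resp. to
   {i | x_i = t y_i} for the largest t with t y <= x. *)

Section TensorAction.
Variables (R : realType) (n k : nat).
Implicit Types (A : tensor R n k) (x y : 'rV[R]_n).

(** * Homogeneity and normalization *)

Lemma tensor_applyE A x i : tensor_apply A x 0 i =
  \sum_(J : k.-tuple 'I_n | ohead J == Some i)
    A J * \prod_(j <- behead J) x 0 j.
Proof. by rewrite mxE. Qed.

Lemma phiE q x i : (0 < q)%N -> 0 <= x 0 i -> phi q x 0 i = x 0 i ^+ q.
Proof.
move=> q0 x0; rewrite mxE ger0_norm//.
move: x0; rewrite le_eqVlt => /orP[/eqP <-|x0]; last by rewrite gtr0_sg// mul1r.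
by rewrite expr0n gtn_eqF// mulr0.
Qed.

Lemma phiZ q (t : R) x : 0 < t -> phi q (t *: x) = t ^+ q *: phi q x.
Proof.
move=> t0; apply/rowP => i; rewrite !mxE sgrM gtr0_sg// mul1r.
by rewrite normrM gtr0_norm// exprMn mulrCA.
Qed.

Lemma lnormZ (t : R) x : (0 < k)%N -> 0 <= t ->
  lnorm k (t *: x) = t * lnorm k x.
Proof.
move=> k0 t0; rewrite /lnorm.
under eq_bigr do rewrite mxE normrM ger0_norm// exprMn.
rewrite -big_distrr powRM ?exprn_ge0//; last first.
  by apply: sumr_ge0 => i _; rewrite exprn_ge0.
congr (_ * _); rewrite -powR_mulrn// -powRrM divff ?powRr1//.
by rewrite pnatr_eq0 lt0n_neq0.
Qed.

Lemma lnorm_gt0 (p : nat) x i : x 0 i != 0 -> 0 < lnorm p x.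
Proof.
move=> xi; rewrite /lnorm powR_gt0// (bigD1 i)//=.
rewrite ltr_wpDr ?exprn_gt0 ?normr_gt0//.
by apply: sumr_ge0 => j _; rewrite exprn_ge0.
Qed.

Lemma tensor_applyZ A (t : R) x :
  tensor_apply A (t *: x) = t ^+ k.-1 *: tensor_apply A x.
Proof.
apply/rowP => i; rewrite !mxE big_distrr; apply: eq_bigr => J _ /=.
under eq_bigr do rewrite mxE.
rewrite big_split /= big_const_seq count_predT size_behead size_tuple.
by rewrite -Monoid.iteropE /= mulrCA.
Qed.

Lemma tensor_apply0 A : (2 <= k)%N -> tensor_apply A 0 = 0.
Proof.
move=> k2; rewrite -[in LHS](scaler0 _ 0) tensor_applyZ expr0n.
by rewrite gtn_eqF ?scale0r// -subn1 subn_gt0.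
Qed.

(** Both sides of the eigenvalue equation are homogeneous of degree [k.-1], so rescaling the vector
    keeps [mu]. *)
Lemma mode1_eigenpair_normalize A mu x : (0 < k)%N -> x != 0 ->
  tensor_apply A x = mu *: phi k.-1 x ->
  mode1_eigenpair A mu ((lnorm k x)^-1 *: x).
Proof.
move=> k0 /rV0Pn[i xi] eig; have l0 := lnorm_gt0 k xi.
split; first by rewrite lnormZ ?invr_ge0 ?ltW// mulVf ?gt_eqF.
by rewrite tensor_applyZ phiZ ?invr_gt0// eig !scalerA mulrC.
Qed.

(** * Monotonicity for nonnegative tensors *)

Lemma tensor_apply_ge0 A x i : tensor_nonneg A ->
  (forall j, 0 <= x 0 j) -> 0 <= tensor_apply A x 0 i.
Proof.
move=> A0 x0; rewrite tensor_applyE; apply: sumr_ge0 => J _.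
by apply: mulr_ge0 => //; apply: prodr_ge0.
Qed.

Lemma ler_tensor_apply A x y i : tensor_nonneg A ->
  (forall j, 0 <= x 0 j <= y 0 j) ->
  tensor_apply A x 0 i <= tensor_apply A y 0 i.
Proof.
move=> A0 xy; rewrite !tensor_applyE; apply: ler_sum => J _.
by apply: ler_wpM2l => //; apply: ler_prod.
Qed.

(** * Irreducibility in terms of index sets *)

(** Listing [K] first and then its complement enumerates all indices once; [s] reads off this
    list. *)
Lemma perm_block (K : {set 'I_n}) :
  exists s : 'S_n, forall i : 'I_n, (i < #|K|)%N = (s i \in K).
Proof.
pose e := enum K ++ enum (~: K).
have se : size e = n by rewrite size_cat -!cardE cardsC card_ord.
have : perm_eq e (ord_tuple n).
  apply: uniq_perm; rewrite ?val_ord_tuple ?enum_uniq//.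
    rewrite cat_uniq !enum_uniq andbT /=.
    by apply/hasPn => j; rewrite !mem_enum inE.
  by move=> j; rewrite mem_cat !mem_enum inE orbN.
case/tuple_permP => s es; exists s => i.
have <- : nth i e i = s i.
  by rewrite es -tnth_nth tnth_mktuple tnth_ord_tuple.
rewrite nth_cat -cardE; case: ltnP => iK.
  by rewrite -mem_enum mem_nth// -cardE.
apply/esym/negbTE; have : nth i (enum (~: K)) (i - #|K|) \in enum (~: K).
  by rewrite mem_nth// -cardE ltn_subLR// cardsC card_ord.
by rewrite mem_enum inE.
Qed.

(** A permutation sending the initial block onto the complement of [I] turns the absence of such an
    entry into the vanishing block of a reducible tensor. *)
Lemma irreducible_witness A (I : {set 'I_n}) : (0 < k)%N -> irreducible A ->
  I != set0 -> I != setT ->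
  exists i (J : k.-tuple 'I_n), [/\ i \in I, ohead J = Some i,
    all (fun j => j \notin I) (behead J) & A J != 0].
Proof.
move=> k0 irr I0 IT; apply: contra_notP irr => noJ.
have [s sP] := perm_block (~: I).
exists s, #|~: I|; split.
  rewrite card_gt0 -[X in (_ < X)%N]card_ord -(cardsC I) addnC.
  rewrite -[X in (X < _)%N]addn0 ltn_add2l card_gt0 I0 andbT.
  by apply: contra_neq IT => /(congr1 (@setC _)); rewrite setCK setC0.
move=> i J hJ mi allJ; rewrite ffunE; apply/eqP/negPn/negP => AJ.
apply: noJ; exists (s i), (map_tuple s J); split => //.
- by move: mi; rewrite leqNgt sP inE negbK.
- by rewrite /=; case: (tval J) hJ => //= a l [->].
- rewrite /= behead_map all_map; apply: sub_all allJ => j /=.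
  by rewrite sP inE.
Qed.

(** The index is the head of a nonzero entry whose other indices avoid [I], so it depends on [I]
    alone; the monomial of that entry grows strictly, the others do not decrease. *)
Lemma ltr_tensor_apply A (I : {set 'I_n}) : (2 <= k)%N -> irreducible A ->
  tensor_nonneg A -> I != set0 -> I != setT ->
  exists2 i, i \in I & forall x y,
    (forall j, 0 <= x 0 j <= y 0 j) ->
    (forall j, j \notin I -> x 0 j < y 0 j) ->
    tensor_apply A x 0 i < tensor_apply A y 0 i.
Proof.
move=> k2 irr A0 I0 IT.
have [i [J [iI hJ /allP allJ AJ]]] := irreducible_witness (ltnW k2) irr I0 IT.
exists i => // x y xy xyI; rewrite !tensor_applyE.
rewrite (bigD1 J) ?hJ//= [ltRHS](bigD1 J) ?hJ//=.
apply: ltr_leD; last first.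
  by apply: ler_sum => L _; apply: ler_wpM2l => //; apply: ler_prod.
(* Strictness needs a nonempty product: [behead J] has [k.-1 >= 1] elements. *)
rewrite ltr_pM2l ?lt0r ?AJ ?A0// big_seq [ltRHS]big_seq; apply: ltr_prod.
  case: (behead J) (size_behead J) => [|a l _]; last by rewrite /= mem_head.
  by rewrite size_tuple => /eqP; rewrite eq_sym -subn1 subn_eq0 leqNgt k2.
by move=> j jJ; case/andP: (xy j) => -> _; apply/xyI/allJ.
Qed.

(** A singleton is a proper index set once [n >= 2]; for [n = 1] irreducibility is vacuous and the
    separate hypothesis supplies the entry. *)
Lemma irreducible_neq0 A : (0 < n)%N -> (2 <= k)%N -> (n = 1%N -> A <> 0) ->
  irreducible A -> exists J, A J != 0.
Proof.
move=> n0 k2 n1 irr; move: n0; rewrite leq_eqVlt => /orP[/eqP en|n2].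
  apply/existsP; apply: contra_notT (n1 (esym en)).
  by move=> /existsPn h; apply/ffunP => J; rewrite ffunE; apply/eqP/negPn/h.
have /(irreducible_witness (ltnW k2) irr)[] : [set Ordinal (ltnW n2)] != set0.
- by apply/set0Pn; exists (Ordinal (ltnW n2)); rewrite inE.
- apply/eqP => /(congr1 (fun B : {set _} => #|B|)).
  rewrite cards1 cardsT card_ord => e1.
  by have := n2; rewrite -e1.
- by move=> i [J [_ _ _ AJ]]; exists J.
Qed.


(** * Positivity and uniqueness of nonnegative eigenvectors *)

Lemma eigenvector_gt0 A mu x : (2 <= k)%N -> irreducible A -> tensor_nonneg A ->
  tensor_apply A x = mu *: phi k.-1 x -> x != 0 -> (forall i, 0 <= x 0 i) ->
  forall i, 0 < x 0 i.
Proof.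
move=> k2 irr A0 eig xN0 x0 i; rewrite lt0r x0 andbT.
apply: contraT; rewrite negbK => xi0.
have q0 : (0 < k.-1)%N by rewrite -subn1 subn_gt0.
pose Z := [set j | x 0 j == 0].
have ZN0 : Z != set0 by apply/set0Pn; exists i; rewrite inE.
have ZNT : Z != setT.
  apply: contraNneq xN0 => ZT; apply/eqP/rowP => j; rewrite mxE.
  by have := in_setT j; rewrite -ZT inE => /eqP.
have [j + strict] := ltr_tensor_apply k2 irr A0 ZN0 ZNT; rewrite inE => /eqP xj.
(* The comparison of 0 with [x] is strict off [Z], yet at [j] in [Z] the eigenvalue equation makes
   the right side 0. *)
have : tensor_apply A 0 0 j < tensor_apply A x 0 j.
  apply: strict => l; rewrite mxE ?x0 ?lexx// inE => xl.
  by rewrite lt0r x0 xl.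
rewrite eig [X in _ < X]mxE phiE// xj expr0n gtn_eqF// mulr0 ltNge.
by rewrite tensor_apply_ge0// => l; rewrite mxE.
Qed.

(** The sign of [mu] is read off the eigenvalue equation at the head of a nonzero entry, where [A x]
    is positive. *)
Lemma eigenvalue_gt0 A mu x : (0 < n)%N -> (2 <= k)%N -> (n = 1%N -> A <> 0) ->
  irreducible A -> tensor_nonneg A -> (forall i, 0 < x 0 i) ->
  tensor_apply A x = mu *: phi k.-1 x -> 0 < mu.
Proof.
move=> n0 k2 n1 irr A0 x0 eig.
have [J AJ] := irreducible_neq0 n0 k2 n1 irr.
have q0 : (0 < k.-1)%N by rewrite -subn1 subn_gt0.
case hJ : (ohead J) => [i|]; last first.
  by move: (size_tuple J) hJ k2; case: (tval J) => //= <-.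
have : 0 < tensor_apply A x 0 i.
  rewrite tensor_applyE (bigD1 J) ?hJ//= ltr_wpDr//.
    apply: sumr_ge0 => L _; apply: mulr_ge0 => //.
    by apply: prodr_ge0 => j _; apply/ltW.
  by rewrite mulr_gt0 ?prodr_gt0// lt0r AJ A0.
by rewrite eig mxE phiE ?ltW// pmulr_lgt0// exprn_gt0.
Qed.

(** For the largest [t] with [t y <= x], a proper equality set would contain an [i] with
    [(A (t y))_i < (A x)_i]; since [x_i = t y_i], this says [nu < mu]. *)
Lemma eigenvector_ratio A mu nu x y : (0 < n)%N -> (2 <= k)%N ->
  irreducible A -> tensor_nonneg A ->
  (forall i, 0 < x 0 i) -> (forall i, 0 < y 0 i) ->
  tensor_apply A x = mu *: phi k.-1 x -> tensor_apply A y = nu *: phi k.-1 y ->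
  mu <= nu -> exists2 t, 0 < t & x = t *: y.
Proof.
move=> n0 k2 irr A0 x0 y0 eigx eigy munu.
have q0 : (0 < k.-1)%N by rewrite -subn1 subn_gt0.
have [t [t0 tyx [i1 xi1]]] : exists t,
    [/\ 0 < t, (forall j, t * y 0 j <= x 0 j) & exists i, x 0 i = t * y 0 i].
  (* The largest such [t] is the least ratio [x_i / y_i], attained at [i]. *)
  have [i _ min_i] :=
    @arg_minP _ R 'I_n (Ordinal n0) xpredT (fun i => x 0 i / y 0 i) isT.
  exists (x 0 i / y 0 i); split; first by rewrite divr_gt0.
    by move=> j; rewrite -ler_pdivlMr// min_i.
  by exists i; rewrite divfK// gt_eqF.
exists t => //; pose I := [set i | x 0 i == t * y 0 i].
suff IT : I = setT.
  by apply/rowP => i; rewrite mxE; have := in_setT i; rewrite -IT inE => /eqP.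
apply/eqP; apply: contraT => INT.
have IN0 : I != set0 by apply/set0Pn; exists i1; rewrite inE xi1.
have [i + strict] := ltr_tensor_apply k2 irr A0 IN0 INT; rewrite inE => /eqP xi.
have : tensor_apply A (t *: y) 0 i < tensor_apply A x 0 i.
  apply: strict => j; rewrite mxE; first by rewrite tyx andbT mulr_ge0 ?ltW.
  by rewrite inE lt_neqAle eq_sym tyx andbT.
rewrite tensor_applyZ eigx eigy scalerA [X in X < _]mxE [X in _ < X]mxE.
rewrite !phiE ?ltW// xi exprMn [X in _ < X]mulrA ltNge ler_pM2r ?exprn_gt0//.
by rewrite [leLHS]mulrC ler_pM2l ?exprn_gt0// munu.
Qed.

(** * Subinvariant vectors and their perturbation *)

Lemma continuous_exprn_comp (T : topologicalType) (f : T -> R) (q : nat) :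
  continuous f -> continuous (fun u => f u ^+ q).
Proof.
move=> cf u.
apply: (@continuous_comp _ _ _ f (fun v => v ^+ q)); first exact: cf.
exact: exprn_continuous.
Qed.

(** Finitely many strict inequalities at 0 survive on a common right neighbourhood. This supplies
    the small perturbations of the vector and of [lam]. *)
Lemma pos_arg_lt (I : finType) (f : I -> R -> R) (c : I -> R) :
  (forall i, continuous (f i)) -> (forall i, f i 0 < c i) ->
  exists2 e, 0 < e & forall i, f i e < c i.
Proof.
move=> cf f0c; near (at_right (0 : R)) => e; exists e => //; near: e.
apply: filter_forall => i; apply: (cvgr_lt (f i 0)) => //.
by apply: cvg_at_right_filter; exact: cf.
Unshelve. all: by end_near. Qed.

(** For nonzero [x >= 0] and [k >= 2], the largest such [lam] is the Collatz-Wielandt number, the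
    minimum of [(A x)_i / x_i^(k-1)] over [x_i > 0]. *)
Definition subinvariant A (lam : R) x :=
  forall i, lam * x 0 i ^+ k.-1 <= tensor_apply A x 0 i.

(** Induction on the number of tight indices. Raising [x] off the tight set leaves the left sides on
    that set unchanged, while some right side there grows strictly. *)
Lemma strict_subinvariant A lam x i0 : (2 <= k)%N -> irreducible A ->
  tensor_nonneg A -> 0 <= lam -> (forall i, 0 <= x 0 i) ->
  subinvariant A lam x -> lam * x 0 i0 ^+ k.-1 < tensor_apply A x 0 i0 ->
  exists z : 'rV_n, [/\ z != 0, forall i, 0 <= z 0 i &
    forall i, lam * z 0 i ^+ k.-1 < tensor_apply A z 0 i].
Proof.
move=> k2 irr A0 lam0.
have q0 : (0 < k.-1)%N by rewrite -subn1 subn_gt0.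
pose I y := [set i | lam * y 0 i ^+ k.-1 == tensor_apply A y 0 i].
have [m] := ubnP #|I x|; elim: m x i0 => // m IH x i0 Im x0 subx ltx.
have i0I : i0 \notin I x by rewrite inE lt_eqF.
have ltI i : i \notin I x -> lam * x 0 i ^+ k.-1 < tensor_apply A x 0 i.
  by rewrite inE lt_neqAle => ->; rewrite subx.
have IxT : I x != setT by apply: contraNneq i0I => ->; rewrite inE.
have [I0|IxN0] := eqVneq (I x) set0.
  exists x; split => //; last by move=> i; rewrite ltI// I0 inE.
  apply: contraTneq ltx => ->.
  by rewrite tensor_apply0// !mxE expr0n gtn_eqF// mulr0 ltxx.
have [i1 i1I strict] := ltr_tensor_apply k2 irr A0 IxN0 IxT.
(* The extra 1 at tight indices makes the inequality strict at [e = 0] there too; only the other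
   indices are used later. *)
have [e e0 ltxe] : exists2 e, 0 < e & forall i,
    lam * (x 0 i + e) ^+ k.-1 < tensor_apply A x 0 i + (i \in I x)%:R.
  apply: (@pos_arg_lt _ (fun i e => lam * (x 0 i + e) ^+ k.-1)) => i.
    move=> e; apply: cvgM; first exact: cvg_cst.
    apply: continuous_exprn_comp => u.
    by apply: cvgD; [exact: cvg_cst|exact: cvg_id].
  rewrite addr0; have [iI|iI] := boolP (i \in I x); last by rewrite addr0 ltI.
  by apply: (le_lt_trans (subx i)); rewrite ltrDl.
pose y := \row_i (x 0 i + e *+ (i \notin I x)).
have xy i : 0 <= x 0 i <= y 0 i by rewrite mxE x0 lerDl mulrn_wge0// ltW.
have xyI i : i \notin I x -> x 0 i < y 0 i by move=> iI; rewrite mxE iI ltrDl.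
have yI i : i \in I x -> y 0 i = x 0 i by move=> iI; rewrite mxE iI addr0.
have Fxy i := ler_tensor_apply i A0 xy.
have lty i : i \notin I x -> lam * y 0 i ^+ k.-1 < tensor_apply A y 0 i.
  move=> iI; apply: lt_le_trans (Fxy i).
  by have := ltxe i; rewrite (negbTE iI) addr0 [y 0 i]mxE iI.
have lty1 : lam * y 0 i1 ^+ k.-1 < tensor_apply A y 0 i1.
  by rewrite yI//; apply: le_lt_trans (subx i1) (strict _ _ xy xyI).
apply: (IH y i0); last exact: lty.
(* No index becomes tight, and [i1] ceases to be. *)
- suff : I y \proper I x by move=> /proper_card /leq_trans; apply.
  apply/properP; split; last by exists i1; rewrite // inE lt_eqF.
  by apply/subsetP => i; apply: contraTT => iI; rewrite inE lt_eqF ?lty.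
- by move=> i; case/andP: (xy i); apply: le_trans.
- move=> i; have [iI|/lty/ltW//] := boolP (i \in I x).
  by rewrite yI//; apply: le_trans (subx i) (Fxy i).
Qed.

Lemma continuous_tensor_apply A i :
  continuous (fun u : 'rV[R]_n => tensor_apply A u 0 i).
Proof.
under eq_fun do rewrite tensor_applyE.
apply: continuous_big; first exact: add_continuous.
move=> J _ u; apply: continuousM; first exact: cst_continuous.
move: u; apply: continuous_big; first exact: mul_continuous.
by move=> j _; exact: coord_continuous.
Qed.

(** At a largest coordinate [x_i], comparing [x] with the constant vector [x_i] gives
    [lam <= (A 1)_i]. Summing over all indices makes the bound independent of [x]. *)
Lemma subinvariant_le A lam x : tensor_nonneg A ->
  (forall i, 0 <= x 0 i) -> x != 0 -> subinvariant A lam x ->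
  lam <= \sum_i tensor_apply A (const_mx 1) 0 i.
Proof.
move=> A0 x0 /rV0Pn[i0 xi0] sub.
have [i _ max_i] := @arg_maxP _ R 'I_n i0 xpredT (fun i => x 0 i) isT.
have {}max_i j : x 0 j <= x 0 i := max_i j isT.
have xi : 0 < x 0 i by apply: lt_le_trans (max_i i0); rewrite lt0r xi0 x0.
have xc j : 0 <= x 0 j <= (x 0 i *: const_mx 1 : 'rV_n) 0 j.
  by rewrite !mxE mulr1 x0 max_i.
apply: (@le_trans _ _ (tensor_apply A (const_mx 1) 0 i)); last first.
  rewrite (bigD1 i)//= lerDl; apply: sumr_ge0 => j _.
  by apply: tensor_apply_ge0 => // l; rewrite mxE.
rewrite -(ler_pM2r (exprn_gt0 k.-1 xi)); apply: le_trans (sub i) _.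
by have := ler_tensor_apply i A0 xc; rewrite tensor_applyZ [leRHS]mxE mulrC.
Qed.

Lemma subinvariantZ A lam t x : 0 <= t -> subinvariant A lam x ->
  subinvariant A lam (t *: x).
Proof.
move=> t0 sub i; rewrite tensor_applyZ !mxE exprMn mulrCA.
by have := sub i; rewrite mxE; apply: ler_wpM2l; rewrite exprn_ge0.
Qed.

(** * Existence by maximization over a compact set *)

Lemma max_subinvariant A : (0 < n)%N -> tensor_nonneg A ->
  exists lam x, [/\ 0 <= lam, x != 0, forall i, 0 <= x 0 i,
    subinvariant A lam x &
    forall mu y, 0 <= mu -> y != 0 -> (forall i, 0 <= y 0 i) ->
      subinvariant A mu y -> mu <= lam].
Proof.
move=> n0 A0; pose M := \sum_i tensor_apply A (const_mx 1) 0 i.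
(* Pairs [(lam, x)] range over a compact box [B], cut by the closed conditions of subinvariance [D]
   and unit coordinate sum [S]. *)
pose B : set (R * 'rV[R]_n) :=
  (`[0, M] `*` [set v : 'rV[R]_n | forall i, `[0, 1] (v ord0 i)])%classic.
pose D : set (R * 'rV[R]_n) := (\bigcap_(i : 'I_n)
  [set p : R * 'rV[R]_n |
    (p.1 * p.2 0 i ^+ k.-1 - tensor_apply A p.2 0 i <= 0)%R])%classic.
pose S : set (R * 'rV[R]_n) :=
  [set p : R * 'rV[R]_n | \sum_i p.2 0 i = 1]%classic.
have cB : compact B.
  apply: compact_setX; first exact: segment_compact.
  apply: (@rV_compact R n (fun=> `[0, 1]%classic)) => i.
  exact: segment_compact.
have c1 : continuous (fun p : R * 'rV[R]_n => p.1) by move=> p; exact: cvg_fst.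
have c2 : continuous (fun p : R * 'rV[R]_n => p.2) by move=> p; exact: cvg_snd.
have c2i i : continuous (fun p : R * 'rV[R]_n => p.2 0 i).
  move=> p; apply: (@continuous_comp _ _ _ snd (fun v : 'rV[R]_n => v 0 i)).
    exact: c2.
  exact: coord_continuous.
have clD : topology_structure.closed D.
  apply: closed_bigI => i _.
  apply: (@closed_comp _ _ (fun p : R * 'rV[R]_n =>
      p.1 * p.2 0 i ^+ k.-1 - tensor_apply A p.2 0 i)
    [set u | u <= 0]%classic); last exact: closed_le.
  move=> p _; apply: cvgB.
    by apply: cvgM; [exact: c1|exact: continuous_exprn_comp].
  apply: (@continuous_comp _ _ _ snd
    (fun v : 'rV[R]_n => tensor_apply A v 0 i)); first exact: c2.
  exact: continuous_tensor_apply.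
have clS : topology_structure.closed S.
  apply: (@closed_comp _ _ (fun p : R * 'rV[R]_n => \sum_i p.2 0 i)
    [set u | u = 1]%classic); last exact: closed_eq.
  by move=> p _; apply: continuous_big => //; exact: add_continuous.
(* Subinvariance is invariant under positive scaling, so the normalization loses no value of
   [mu]. *)
have normB mu y : 0 <= mu -> y != 0 -> (forall i, 0 <= y 0 i) ->
    subinvariant A mu y -> exists z, (B `&` (D `&` S))%classic (mu, z).
  move=> mu0 yN0 y0 sub; pose s := \sum_i y 0 i.
  have s0 : 0 < s.
    have /rV0Pn[i yi] := yN0; rewrite /s (bigD1 i)//= ltr_wpDr ?sumr_ge0//.
    by rewrite lt0r yi y0.
  have z1 : \sum_i (s^-1 *: y) 0 i = 1.
    by under eq_bigr do rewrite mxE; rewrite -mulr_sumr mulVf ?gt_eqF.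
  have z0 i : 0 <= (s^-1 *: y) 0 i by rewrite mxE mulr_ge0// invr_ge0 ltW.
  exists (s^-1 *: y); split; last split => //.
    split => /=; first by rewrite in_itv/= mu0 (subinvariant_le A0 y0).
    move=> i; rewrite in_itv/= z0 -z1 (bigD1 i)//= lerDl sumr_ge0//.
  move=> i _ /=; rewrite subr_le0.
  by apply: subinvariantZ => //; rewrite invr_ge0 ltW.
have : ((B `&` (D `&` S)) !=set0)%classic.
  have [z zP] : exists z, (B `&` (D `&` S))%classic (0, z).
    apply: (normB 0 (const_mx 1)) => //.
    - by apply/rV0Pn; exists (Ordinal n0); rewrite mxE oner_neq0.
    - by move=> i; rewrite mxE.
    - by move=> i; rewrite mul0r tensor_apply_ge0// => j; rewrite mxE.
  by exists (0, z).
move=> /(@compact_EVT_max _ R fst)[].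
- by apply: compact_closedI => //; exact: closedI.
- by apply: continuous_subspaceT; exact: c1.
move=> [lam x] /set_mem[[/= lamM x01] [subx sumx]] maxl.
exists lam, x; split.
- by move: lamM; rewrite in_itv/= => /andP[].
- apply/eqP => x0; move: sumx; rewrite /S /= x0.
  under eq_bigr do rewrite mxE.
  by rewrite big1// => /eqP; rewrite eq_sym oner_eq0.
- by move=> i; have := x01 i; rewrite /= in_itv/= => /andP[].
- by move=> i; have := subx i I; rewrite /= subr_le0.
- move=> mu y mu0 yN0 y0 sub; have [z zP] := normB mu y mu0 yN0 y0 sub.
  by apply: (maxl (mu, z)); exact: mem_set.
Qed.

Lemma nonneg_eigenvector A : (0 < n)%N -> (2 <= k)%N -> irreducible A ->
  tensor_nonneg A ->
  exists mu x, [/\ x != 0, forall i, 0 <= x 0 i &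
    tensor_apply A x = mu *: phi k.-1 x].
Proof.
move=> n0 k2 irr A0; have q0 : (0 < k.-1)%N by rewrite -subn1 subn_gt0.
have [lam [x [lam0 xN0 x0 subx maxlam]]] := max_subinvariant n0 A0.
exists lam, x; split => //; apply/rowP => i; rewrite [RHS]mxE phiE//.
apply/eqP; rewrite eq_sym eq_le subx andTb leNgt; apply/negP => lti.
have [z [zN0 z0 ltz]] := strict_subinvariant k2 irr A0 lam0 x0 subx lti.
(* Strictness at every index leaves room to enlarge [lam], against its maximality. *)
have [d d0 ltd] : exists2 d, 0 < d & forall i,
    (lam + d) * z 0 i ^+ k.-1 < tensor_apply A z 0 i.
  apply: (@pos_arg_lt _ (fun i d => (lam + d) * z 0 i ^+ k.-1)) => j.
    move=> d; apply: cvgM; last exact: cvg_cst.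
    by apply: cvgD; [exact: cvg_cst|exact: cvg_id].
  by rewrite addr0.
have := maxlam (lam + d) z _ zN0 z0 (fun j => ltW (ltd j)).
by rewrite gerDl (lt_geF d0) addr_ge0 ?(ltW d0)// => /(_ isT).
Qed.

End TensorAction.

(** * Existence, positivity and uniqueness combined *)

Theorem theorem1 (R : realType) (n k : nat) (A : tensor R n k)
    (n_gt0 : (0 < n)%N) (k_ge2 : (2 <= k)%N)
    (A_neq0 : n = 1%N -> A <> 0)
    (A_irr : irreducible A) (A_ge0 : tensor_nonneg A) :
  exists (mu : R) (x : 'rV[R]_n),
    [/\ 0 < mu,
        mode1_eigenpair A mu x,
        (forall i : 'I_n, 0 <= x 0 i),
        (forall (nu : R) (y : 'rV[R]_n),
            mode1_eigenpair A nu y -> (forall i : 'I_n, 0 <= y 0 i) -> y = x)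
      & (forall i : 'I_n, 0 < x 0 i)].
Proof.
have k0 : (0 < k)%N by apply: ltnW.
have [mu [x [xN0 x0 eigx]]] := nonneg_eigenvector n_gt0 k_ge2 A_irr A_ge0.
have xgt0 := eigenvector_gt0 k_ge2 A_irr A_ge0 eigx xN0 x0.
have l0 : 0 < lnorm k x by have /rV0Pn[i xi] := xN0; apply: lnorm_gt0 xi.
have [normx' eigx'] := mode1_eigenpair_normalize k0 xN0 eigx.
set x' := _ *: x in normx' eigx'.
have x'gt0 i : 0 < x' 0 i by rewrite mxE mulr_gt0 ?invr_gt0.
exists mu, x'; split => //.
- exact: eigenvalue_gt0 eigx.
- by move=> i; exact: ltW.
move=> nu y [normy eigy] y0.
have yN0 : y != 0.
  apply/eqP => yE; move: normy; rewrite yE -(scale0r 0) lnormZ// mul0r => /eqP.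
  by rewrite eq_sym oner_eq0.
have ygt0 := eigenvector_gt0 k_ge2 A_irr A_ge0 eigy yN0 y0.
(* The order of the eigenvalues decides which vector is written as a multiple of the other; as both
   have norm 1, the factor is 1. *)
have [munu|/ltW numu] := leP mu nu.
  have [t t0 xE] :=
    eigenvector_ratio n_gt0 k_ge2 A_irr A_ge0 x'gt0 ygt0 eigx' eigy munu.
  by move: normx'; rewrite xE lnormZ ?ltW// normy mulr1 => ->; rewrite scale1r.
have [t t0 yE] :=
  eigenvector_ratio n_gt0 k_ge2 A_irr A_ge0 ygt0 x'gt0 eigy eigx' numu.
by move: normy; rewrite yE lnormZ ?ltW// normx' mulr1 => ->; rewrite scale1r.
Qed.
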